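(* Let $\xi\in\mathbb C^{q\times q}$ and $\nu\in\mathbb C^{p\times p}$ be nonsingular. Assume that $\mathscr H$ is bounded on $\ell^2$ of its index set. If $z^{-1}=\tau^M$ and $|\tau|<\|\mathscr H\|_2^{-1}$, then \[ \mathsf S(z)=\frac1z\,\xi^{-1}\,\mathsf Q_q\,(I-\tau\mathscr H)^{-1}\,\mathsf Q_p^{\mathsf T}\,\nu^{-\mathsf T}. \] The right-hand side is independent of the choice of the $M$-th root $\tau$.
   Context: Let $p,q\ge1$, $M=p+q$, $d=\gcd(p,q)$, $P=p/d$, $Q=q/d$, $R=P+Q$. Let $L_1,\dots,L_p$ be semi-infinite (indexed by $\mathbb N_0$) lower bidiagonal matrices with $(L_a)_{n,n}=1$, $(L_a)_{n+1,n}=\ell_n^{(a)}\in\mathbb C$, and $U_1,\dots,U_q$ upper bidiagonal with $(U_b)_{n,n}=u_n^{(b)}\in\mathbb C$, $(U_b)_{n,n+1}=1$, and let $T=L_1\cdots L_pU_q\cdots U_1$. Height-ordered matrix $\mathscr H$ of this factor order: put $\omega_j=(j-1)Q$ for $1\le j\le p$ and $\omega_{p+b}=(q-b+1)P$ for $1\le b\le q$. Rows and columns are indexed by pairs $(h,j)$ with $h\in\mathbb N_0$, $j\in\{1,\dots,M\}$, $h-\omega_j\in R\mathbb N_0$, ordered by $h$ and then $j$; $n_j(h)=(h-\omega_j)/R$; $j^+=j+1$ for $j<M$, $M^+=1$. The only nonzero entries are $\mathscr H_{(h,j),(h+Q,j^+)}=1$; $\mathscr H_{(h,j),(h-P,j^+)}=\ell^{(j)}_{n_j(h)-1}$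 for $1\le j\le p$, $n_j(h)\ge1$; $\mathscr H_{(h,p+b),(h-P,(p+b)^+)}=u^{(q-b+1)}_{n_{p+b}(h)}$ for $1\le b\le q$. $\mathsf Q_r$ is the coordinate projection onto the $r$ coordinates $(h,1)$ with $n_1(h)=h/R=0,1,\dots,r-1$ (in this order). $\mathsf E_{[r]}=[\,I_r\ 0\ 0\cdots]$ is the projection onto the first $r$ coordinates of the original sequence space. Boundedness of $\mathscr H$ on $\ell^2$ implies boundedness of $T$ on $\ell^2(\mathbb N_0)$; the normalized rectangular Weyl matrix is $\mathsf S(z)=\xi^{-1}\mathsf E_{[q]}(zI-T)^{-1}\mathsf E_{[p]}^{\mathsf T}\nu^{-\mathsf T}$ for $z$ in the resolvent set of $T$. $\|\cdot\|_2$ is the operator norm on $\ell^2$ and $X^{-\mathsf T}=(X^{-1})^{\mathsf T}$. *)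

(* Defs.v *)
From HB Require Import structures.
From mathcomp Require Import all_boot all_order all_algebra.
From mathcomp Require Import complex.
From mathcomp Require Import boolp classical_sets functions cardinality fsbigop.
From mathcomp Require Import reals ereal esum.

Set Implicit Arguments.
Unset Strict Implicit.
Unset Printing Implicit Defensive.

Import Order.TTheory GRing.Theory Num.Theory.
Import Normc.

Local Open Scope classical_set_scope.
Local Open Scope ring_scope.

Section SquareSummable.
Context {R : realType} {I : choiceType}.
Implicit Types (x y : I -> R[i]) (A B : (I -> R[i]) -> (I -> R[i])).

Definition sqnorm x : \bar R := \esum_(i in [set: I]) (normc (x i) ^+ 2)%:E.

Definition l2 : set (I -> R[i]) := [set x | (sqnorm x < +oo)%E].

Definition l2norm x : R := Num.sqrt (fine (sqnorm x)).

(* Operators are functions on all families; only their values on l2 matter. *)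
Definition bounded_op A : Prop :=
  [/\ forall (a : R[i]) x y, l2 x -> l2 y ->
        A (fun i => a * x i + y i) = (fun i => a * A x i + A y i)
    & exists c : R, forall x, l2 x -> l2 (A x) /\ l2norm (A x) <= c * l2norm x].

Definition opnorm A : R :=
  sup [set l2norm (A x) | x in [set x | l2 x /\ l2norm x <= 1]].

Definition l2inverse A B : Prop :=
  [/\ bounded_op A, bounded_op B
    & forall x, l2 x -> B (A x) = x /\ A (B x) = x].

Definition l2invertible A : Prop := exists B, l2inverse A B.

(* Meaningful when A is l2invertible, and then determined on l2. *)
Definition opinv A : (I -> R[i]) -> (I -> R[i]) :=
  xget (fun x => x) [set B | l2inverse A B].

Definition resolvent_set A : set R[i] :=
  [set z | l2invertible (fun x i => z * x i - A x i)].

Definition coord_proj r (f : 'I_r -> I) x : 'cV[R[i]]_r := \col_k x (f k).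

Definition coord_projT r (f : 'I_r -> I) (v : 'cV[R[i]]_r) : I -> R[i] :=
  fun i => \sum_(k < r | f k == i) v k 0.

(* The matrix of the linear map v |-> Pi_f (A (Pi_g^T v)), where Pi_f and Pi_g
   are the projections onto the coordinates listed by f and g. *)
Definition compression r s (f : 'I_r -> I) A (g : 'I_s -> I) : 'M[R[i]]_(r, s) :=
  \matrix_(k, l) coord_proj f (A (coord_projT g (delta_mx l 0))) k 0.

End SquareSummable.

Section InfiniteMatrices.
Context {R : realType} {I : choiceType}.

(* The sums over [set: I] below are finite-support sums; they are the intended
   ones since every row of the matrices considered has finite support. *)
Definition immul (A B : I -> I -> R[i]) : I -> I -> R[i] :=
  fun i j => \sum_(k \in [set: I]) (A i k * B k j).

Definition imid : I -> I -> R[i] := fun i j => (i == j)%:R.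

Definition imop (A : I -> I -> R[i]) (x : I -> R[i]) : I -> R[i] :=
  fun i => \sum_(k \in [set: I]) (A i k * x k).

End InfiniteMatrices.

Section BidiagonalProduct.
Context {R : realType}.

Definition lower_bidiag (l : nat -> R[i]) : nat -> nat -> R[i] :=
  fun n m => if n == m then 1 else if n == m.+1 then l m else 0.

Definition upper_bidiag (u : nat -> R[i]) : nat -> nat -> R[i] :=
  fun n m => if n == m then u n else if m == n.+1 then 1 else 0.

(* L_1 ... L_p U_q ... U_1, with the factors indexed from 0. *)
Definition bidiag_product (p q : nat)
    (ell : 'I_p -> nat -> R[i]) (u : 'I_q -> nat -> R[i]) : nat -> nat -> R[i] :=
  immul (\big[immul/imid]_(a < p) lower_bidiag (ell a))
        (\big[immul/imid]_(b < q) upper_bidiag (u (rev_ord b))).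

End BidiagonalProduct.

Section HeightOrder.
Variables p q : nat.

Definition redP : nat := p %/ gcdn p q.
Definition redQ : nat := q %/ gcdn p q.
Definition redR : nat := redP + redQ.

(* The index j in {1, ..., M} is represented by j - 1 : 'I_(p + q), which
   splits into inl a for j = a + 1 and inr b for j = p + (b + 1). *)
Definition offset (j : 'I_(p + q)) : nat :=
  match fintype.split j with inl a => a * redQ | inr b => (q - b) * redP end.

Definition is_height_index (x : nat * 'I_(p + q)) : bool :=
  (offset x.2 <= x.1)%N && (redR %| x.1 - offset x.2)%N.

(* The order of the indices (by h, then j) does not affect operators on l2. *)
Definition height_index := {x : nat * 'I_(p + q) | is_height_index x}.

Definition height_rank (x : height_index) : nat :=
  (((val x).1 - offset (val x).2) %/ redR)%N.

Hypothesis p_gt0 : (0 < p)%N.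

Definition first_ord : 'I_(p + q) := Ordinal (ltn_addr q p_gt0).

Lemma is_height_index_first (n : nat) :
  is_height_index ((n * redR)%N, first_ord).
Proof.
rewrite /is_height_index /offset /=.
case: splitP => [a /= <-|b /= e]; last first.
  by have := leq_addr b p; rewrite -e leqNgt p_gt0.
by rewrite mul0n /= subn0 dvdn_mull.
Qed.

Definition height_first (n : nat) : height_index :=
  exist _ ((n * redR)%N, first_ord) (is_height_index_first n).

End HeightOrder.

Section HeightMatrix.
Context {R : realType} {p q : nat}.
Variables (ell : 'I_p -> nat -> R[i]) (u : 'I_q -> nat -> R[i]).

(* rev_ord b is the zero-based index of the factor U_(q - b' + 1), b' = b + 1. *)
Definition height_weight (x : height_index p q) : R[i] :=
  let n := height_rank x in
  match fintype.split (val x).2 with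
  | inl a => if (0 < n)%N then ell a n.-1 else 0
  | inr b => u (rev_ord b) n
  end.

Definition height_matrix : height_index p q -> height_index p q -> R[i] :=
  fun x y =>
    if (val y).2 != ordS (val x).2 then 0
    else if (val y).1 == ((val x).1 + redQ p q)%N then 1
    else if ((val y).1 + redP p q)%N == (val x).1 then height_weight x
    else 0.

End HeightMatrix.

Definition weyl_matrix {R : realType} {p q : nat}
    (ell : 'I_p -> nat -> R[i]) (u : 'I_q -> nat -> R[i])
    (xi : 'M[R[i]]_q) (nu : 'M[R[i]]_p) (z : R[i]) : 'M[R[i]]_(q, p) :=
  let T := imop (bidiag_product ell u) in
  invmx xi
  *m compression (fun k : 'I_q => k : nat)
       (opinv (fun x n => z * x n - T x n)) (fun k : 'I_p => k : nat)
  *m (invmx nu)^T.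

Definition height_weyl_matrix {R : realType} {p q : nat} (p_gt0 : (0 < p)%N)
    (ell : 'I_p -> nat -> R[i]) (u : 'I_q -> nat -> R[i])
    (xi : 'M[R[i]]_q) (nu : 'M[R[i]]_p) (z tau : R[i]) : 'M[R[i]]_(q, p) :=
  let H := imop (height_matrix ell u) in
  z^-1 *: (invmx xi
  *m compression (fun k : 'I_q => height_first q p_gt0 k)
       (opinv (fun x i => x i - tau * H x i))
       (fun k : 'I_p => height_first q p_gt0 k)
  *m (invmx nu)^T).

(* Main.v *)
Require Import Defs.
From mathcomp Require Import all_boot all_order all_algebra.
From mathcomp Require Import complex.
From mathcomp Require Import boolp classical_sets reals.
From mathcomp Require Import functions cardinality fsbigop.
From mathcomp Require Import ereal esum topology normedtype sequences.
From mathcomp Require Import ring lra zify.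
Import Order.TTheory GRing.Theory Num.Theory Normc.
Import numFieldNormedType.Exports.

Set Implicit Arguments.
Unset Strict Implicit.
Unset Printing Implicit Defensive.

Local Open Scope classical_set_scope.
Local Open Scope ring_scope.

(** Write M = p + q.  Splitting a family indexed by the height indices into its
M components (one for each column j, numbered from 0, each a sequence on nat)
turns the height matrix H into a block-cyclic matrix: component j of H y is the
j-th factor of T = L_1 ... L_p U_q ... U_1 applied to component j + 1 of y, with
j + 1 taken modulo M ([component_imop_height]).  This is the purpose of the
offsets: with them the steps +Q and -P in the height become the two diagonals of
a bidiagonal matrix.  Going once around the cycle, component 0 of H^M y is T
applied to component 0 of y ([first_component_cycle]), and a family supported on
component 0, equal to x there, is sent by H^M to the family supported on
component 0 and equal to T x there ([iter_height_from_first]), while its image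
under H^n has zero component 0 for 0 < n < M ([iter_height_off]).

Since |tau| ||H|| < 1, the operator I - tau H is invertible by the Neumann
series.  The series is summed coordinate by coordinate, which is enough because
each coordinate of H y depends on finitely many coordinates of y: the limit then
solves y - tau H y = v coordinatewise, and the uniform bound on the norms of the
partial sums passes to it ([neumann_solution]).

Let y = (I - tau H)^-1 v with v supported on component 0, and write y_0, v_0 for
the components 0.  Unrolling y = v + tau H y exactly M times and keeping
component 0 leaves only y_0 = v_0 + tau^M T y_0 ([first_component_feedback]),
that is (z I - T) (z^-1 y_0) = v_0 for z^-1 = tau^M.  So z I - T is onto with a
bounded right inverse.  It is injective because x = tau^M T x makes the sum of
tau^n H^n x over n < M, x being placed on component 0, a fixed point of the
contraction tau H; this sum is then zero, and its component 0 is x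
([bidiag_product_resolvent_inj]).  Thus z is in the resolvent set of T, and
(z I - T)^-1 is z^-1 times the compression of (I - tau H)^-1 to component 0,
which is the identity between the two Weyl matrices.

All M-th roots tau of z^-1 have the same modulus, so the identity holds for each
of them with the same left-hand side. *)

(** * Complex moduli *)

Section Modulus.
Context {R : realType}.
Implicit Types a b : R[i].

Lemma normc_ge0 a : 0 <= normc a.
Proof. by case: a => x y; exact: sqrtr_ge0. Qed.

Lemma sqr_normcE a : normc a ^+ 2 = complex.Re a ^+ 2 + complex.Im a ^+ 2.
Proof. by case: a => x y; rewrite /normc sqr_sqrtr // addr_ge0 ?sqr_ge0. Qed.

Lemma ler_Re_normc a : `|complex.Re a| <= normc a.
Proof.
rewrite -ler_sqr ?nnegrE ?normc_ge0 ?normr_ge0 // sqr_normcE.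
by rewrite real_normK ?num_real // lerDl sqr_ge0.
Qed.

Lemma ler_Im_normc a : `|complex.Im a| <= normc a.
Proof.
rewrite -ler_sqr ?nnegrE ?normc_ge0 ?normr_ge0 // sqr_normcE.
by rewrite real_normK ?num_real // lerDr sqr_ge0.
Qed.

Lemma normcX a n : normc (a ^+ n) = normc a ^+ n.
Proof. by elim: n => [|n IH]; rewrite ?expr0 ?normc1 // !exprS normcM IH. Qed.

(** A weighted form of |a + b|^2 <= (|a| + |b|)^2 that is linear in the squared
moduli, so that it can be summed over the coordinates; choosing t afterwards
gives the triangle inequality in l2. *)
Lemma sqr_normcD_le a b (t : R) : 0 < t ->
  normc (a + b) ^+ 2 <= (1 + t) * normc a ^+ 2 + (1 + t^-1) * normc b ^+ 2.
Proof.
move=> t0; have tn0 : t != 0 by rewrite gt_eqF.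
rewrite !sqr_normcE; case: a b => a1 a2 [b1 b2] /=.
rewrite -subr_ge0.
have -> : (1 + t) * (a1 ^+ 2 + a2 ^+ 2) + (1 + t^-1) * (b1 ^+ 2 + b2 ^+ 2) -
    ((a1 + b1) ^+ 2 + (a2 + b2) ^+ 2)
  = t^-1 * ((t * a1 - b1) ^+ 2 + (t * a2 - b2) ^+ 2) by field.
by rewrite mulr_ge0 ?invr_ge0 ?(ltW t0) ?addr_ge0 ?sqr_ge0.
Qed.

End Modulus.

(** * The norm of l2 through finite partial sums *)

Section L2.
Context {R : realType} {I : choiceType}.
Implicit Types (x y : I -> R[i]) (c : R).

Definition partial_sq x (s : seq I) : R := \sum_(i <- s) normc (x i) ^+ 2.

Lemma sqnorm_fsbig x (s : seq I) : uniq s ->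
  (\sum_(i \in [set` s]) (normc (x i) ^+ 2)%:E = (partial_sq x s)%:E)%E.
Proof. by move=> us; rewrite -fsbig_seq // sumEFin. Qed.

Lemma sqnorm_leP x c :
  (sqnorm x <= c%:E)%E <-> forall s, uniq s -> partial_sq x s <= c.
Proof.
split=> [h s us|h].
  rewrite -lee_fin; apply: le_trans h; rewrite -sqnorm_fsbig //.
  by apply: esum_ge; exists [set` s] => //; split => //; exact: finite_seq.
apply: ge_ereal_sup => _ [F [finF _] <-].
have /finite_seqP[t Ft] := finF.
have := @sqnorm_fsbig x _ (undup_uniq t).
have -> : [set` undup t] = F.
  by rewrite Ft; apply/seteqP; split=> i /=; rewrite mem_undup.
by move=> ->; rewrite lee_fin; apply: h; exact: undup_uniq.
Qed.

Lemma sqnorm_ge0 x : (0 <= sqnorm x)%E.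
Proof. by apply: esum_ge0 => i _; rewrite lee_fin sqr_ge0. Qed.

Lemma l2norm_ge0 x : 0 <= l2norm x.
Proof. exact: sqrtr_ge0. Qed.

Lemma l2_sqnormE x : l2 x -> sqnorm x = (l2norm x ^+ 2)%:E.
Proof.
move=> hx; have fx : sqnorm x \is a fin_num.
  by rewrite fin_numE -ltey hx andbT gt_eqF // (lt_le_trans _ (sqnorm_ge0 x)).
by rewrite /l2norm sqr_sqrtr ?fineK // fine_ge0 // sqnorm_ge0.
Qed.

(** For 0 <= c this says that x is in l2 with norm at most c; it only speaks of
finite sums of reals, which makes it stable under coordinatewise limits. *)
Definition l2_le x c := forall s, uniq s -> partial_sq x s <= c ^+ 2.

Lemma l2_leP x c : 0 <= c -> l2_le x c <-> l2 x /\ l2norm x <= c.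
Proof.
move=> c0; rewrite /l2_le -sqnorm_leP; split=> [h|[hx hn]].
  have lx : l2 x by apply: le_lt_trans h _; exact: ltry.
  by split=> //; rewrite -ler_sqr ?nnegrE ?l2norm_ge0 // -lee_fin -l2_sqnormE.
by rewrite l2_sqnormE // lee_fin ler_sqr ?nnegrE ?l2norm_ge0.
Qed.

Lemma l2_le_norm x : l2 x -> l2_le x (l2norm x).
Proof. by move=> hx; apply/l2_leP; rewrite ?l2norm_ge0. Qed.

Lemma l2_le_coord x c i : 0 <= c -> l2_le x c -> normc (x i) <= c.
Proof.
move=> c0 /(_ [:: i] isT); rewrite /partial_sq big_seq1.
by rewrite ler_sqr ?nnegrE ?normc_ge0.
Qed.

Lemma l2_leZ (a : R[i]) x c : l2_le x c -> l2_le (a *: x) (normc a * c).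
Proof.
move=> h s us; rewrite exprMn /partial_sq.
have -> : \sum_(i <- s) normc ((a *: x) i) ^+ 2 = normc a ^+ 2 * partial_sq x s.
  by rewrite /partial_sq big_distrr; apply: eq_bigr => i _; rewrite normcM exprMn.
by rewrite ler_wpM2l ?sqr_ge0 // h.
Qed.

Lemma l2_leD x y c d : 0 <= c -> 0 <= d ->
  l2_le x c -> l2_le y d -> l2_le (x + y) (c + d).
Proof.
rewrite !le_eqVlt => /predU1P[<- _|c0 /predU1P[<-|d0]] hx hy.
- have -> : x = 0.
    apply/funext => i; apply: eq0_normc; apply/eqP.
    by rewrite eq_le normc_ge0 andbT (l2_le_coord i (lexx 0) hx).
  by rewrite !add0r.
- have -> : y = 0.
    apply/funext => i; apply: eq0_normc; apply/eqP.
    by rewrite eq_le normc_ge0 andbT (l2_le_coord i (lexx 0) hy).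
  by rewrite !addr0.
(* This t minimizes (1 + t) c^2 + (1 + 1/t) d^2, with minimum (c + d)^2. *)
move=> s us; set t := d / c; have t0 : 0 < t by rewrite divr_gt0.
have cn0 : c != 0 by rewrite gt_eqF.
have dn0 : d != 0 by rewrite gt_eqF.
have -> : (c + d) ^+ 2 = (1 + t) * c ^+ 2 + (1 + t^-1) * d ^+ 2.
  by rewrite /t; field; rewrite cn0 dn0.
apply: (@le_trans _ _ ((1 + t) * partial_sq x s + (1 + t^-1) * partial_sq y s)).
  rewrite /partial_sq !mulr_sumr -big_split; apply: ler_sum => i _.
  exact: sqr_normcD_le.
by rewrite lerD // ler_wpM2l ?hx ?hy // addr_ge0 ?invr_ge0 // ltW.
Qed.

Lemma l2_le0 c : l2_le 0 c.
Proof. by move=> s _; rewrite /partial_sq big1 ?sqr_ge0 // => i _; rewrite normc0 expr0n. Qed.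

Lemma l2Z (a : R[i]) x : l2 x -> l2 (a *: x).
Proof.
move=> /l2_le_norm/(l2_leZ a)/l2_leP[] //.
by rewrite mulr_ge0 ?normc_ge0 ?l2norm_ge0.
Qed.

Lemma l2D x y : l2 x -> l2 y -> l2 (x + y).
Proof.
move=> /l2_le_norm hx /l2_le_norm hy.
have /l2_leP[] // := l2_leD (l2norm_ge0 x) (l2norm_ge0 y) hx hy.
by rewrite addr_ge0 ?l2norm_ge0.
Qed.

Lemma l2_0 : l2 (0 : I -> R[i]).
Proof. by have /l2_leP[] := @l2_le0 0. Qed.

Lemma l2B x y : l2 x -> l2 y -> l2 (x - y).
Proof. by move=> hx hy; rewrite -scaleN1r; apply: l2D => //; exact: l2Z. Qed.

Lemma l2norm_eq0 x : l2 x -> l2norm x <= 0 -> x = 0.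
Proof.
move=> hx n0; apply/funext => i; apply: eq0_normc; apply/eqP.
have h : l2_le x 0 by apply/l2_leP.
by rewrite eq_le normc_ge0 andbT (l2_le_coord i (lexx 0) h).
Qed.

Lemma l2_unit (i0 : I) : l2 (fun i => (i0 == i)%:R : R[i]).
Proof.
suff /(l2_leP _ ler01)[] : l2_le (fun i => (i0 == i)%:R : R[i]) 1 by [].
move=> s us; rewrite expr1n /partial_sq.
case: (boolP (i0 \in s)) => hi.
  rewrite (bigD1_seq i0) //= eqxx normc1 expr1n big1 ?addr0 // => i /negbTE.
  by rewrite eq_sym => ->; rewrite normc0 expr0n.
rewrite big1_seq ?ler01 // => i /andP[_ si]; case: eqVneq => [e|_].
  by rewrite e si in hi.
by rewrite normc0 expr0n.
Qed.

End L2.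

Section Pullback.
Context {R : realType} {I J : choiceType}.

Lemma l2_le_comp (e : J -> I) (y : I -> R[i]) c : injective e ->
  l2_le y c -> l2_le (y \o e) c.
Proof.
move=> ei hy s us; have := hy (map e s); rewrite map_inj_uniq // => /(_ us).
by rewrite /partial_sq big_map.
Qed.

(** Extension by zero does not increase the norm: f is injective on the points i
with e (f i) = i, and y vanishes elsewhere. *)
Lemma l2_le_extend (e : J -> I) (f : I -> J) (y : I -> R[i]) c :
  (forall i, e (f i) != i -> y i = 0) -> l2_le (y \o e) c -> l2_le y c.
Proof.
move=> y0 hy s us; set s' := [seq i <- s | e (f i) == i].
have us' : uniq (map f s').
  rewrite map_inj_in_uniq ?filter_uniq // => i k.
  by rewrite !mem_filter => /andP[/eqP ei _] /andP[/eqP ek _] eik; rewrite -ei -ek eik.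
apply: le_trans (hy _ us'); rewrite /partial_sq big_map big_filter.
rewrite (bigID (fun i => e (f i) == i)) /= [X in _ + X]big1 ?addr0.
  by apply: ler_sum => i /eqP ->.
by move=> i /y0 ->; rewrite normc0 expr0n.
Qed.

End Pullback.

(** * Bounded operators and their inverses *)

Section BoundedOperators.
Context {R : realType} {I : choiceType}.
Implicit Types (x y : I -> R[i]) (A B : (I -> R[i]) -> (I -> R[i])) (c : R).

Lemma bounded_op_le A : bounded_op A ->
  exists2 c, 0 <= c & forall x, l2 x -> l2 (A x) /\ l2norm (A x) <= c * l2norm x.
Proof.
case=> _ [c hc]; exists (Num.max c 0); first by rewrite le_max lexx orbT.
move=> x hx; have [hAx le] := hc x hx; split => //.
by apply: le_trans le _; rewrite ler_wpM2r ?l2norm_ge0 // le_max lexx.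
Qed.

Lemma bounded_op_lin A (a : R[i]) x y : bounded_op A -> l2 x -> l2 y ->
  A (a *: x + y) = a *: A x + A y.
Proof. by case=> h _ hx hy; exact: h. Qed.

Lemma bounded_op0 A : bounded_op A -> A 0 = 0.
Proof.
move=> hA; have := bounded_op_lin 1 hA (@l2_0 R I) (@l2_0 R I).
by rewrite !scale1r addr0 => /esym/(congr1 (fun v => v - A 0)); rewrite addrK subrr.
Qed.

Lemma opnorm_le A x : bounded_op A -> l2 x -> l2norm (A x) <= opnorm A * l2norm x.
Proof.
move=> hA hx; have [c c0 hc] := bounded_op_le hA.
have [n0|n0] := leP (l2norm x) 0.
  have -> : x = 0 by apply: l2norm_eq0.
  rewrite bounded_op0 //; have -> : l2norm (0 : I -> R[i]) = 0; last by rewrite mulr0.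
  by apply/le_anti; rewrite l2norm_ge0 andbT; have /l2_leP[] := @l2_le0 R I 0.
(* The supremum ranges over the unit ball: rescale x to norm 1. *)
set n := l2norm x in n0 *.
have hn : normc (n^-1%:C)%C = n^-1.
  by rewrite /normc /= expr0n addr0 sqrtr_sqr ger0_norm // invr_ge0 ltW.
pose x' := (n^-1%:C)%C *: x.
have Ax' : A x' = (n^-1%:C)%C *: A x.
  by rewrite /x' -[_ *: x]addr0 (bounded_op_lin _ hA hx (@l2_0 R I)) bounded_op0 ?addr0.
have : l2norm (A x') <= opnorm A.
  apply: ub_le_sup.
    exists c => _ [v [hv nv] <-]; have [_ le] := hc v hv.
    by apply: le_trans le _; rewrite ler_piMr.
  exists x' => //=; split; first exact: l2Z.
  have /l2_leZ := l2_le_norm hx; move=> /(_ (n^-1%:C)%C).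
  rewrite hn mulVf ?gt_eqF //; move=> /l2_leP[] //.
rewrite -ler_pdivrMr //; apply: le_trans.
have /l2_leZ := l2_le_norm (l2Z (n^-1%:C)%C (hc x hx).1).
move=> /(_ (n%:C)%C); rewrite scalerA -rmorphM divff ?gt_eqF // scale1r.
have -> : normc (n%:C)%C = n by rewrite /normc /= expr0n addr0 sqrtr_sqr ger0_norm // ltW.
rewrite -Ax' => /l2_leP[]; first by rewrite mulr_ge0 ?l2norm_ge0 ?(ltW n0).
by move=> _; rewrite ler_pdivrMr // mulrC.
Qed.

Lemma bounded_op_affine A (a b : R[i]) : bounded_op A ->
  bounded_op (fun x => a *: x + b *: A x).
Proof.
move=> hA; split=> [t x y hx hy|].
  rewrite -[LHS]/(a *: (t *: x + y) + b *: A (t *: x + y)).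
  rewrite -[RHS]/(t *: (a *: x + b *: A x) + (a *: y + b *: A y)).
  rewrite (bounded_op_lin _ hA hx hy) !scalerDr addrACA !scalerA.
  by rewrite [a * t]mulrC [b * t]mulrC.
have [c c0 hc] := bounded_op_le hA.
exists (normc a + normc b * c) => x hx; have [hAx le] := hc x hx.
have n0 := l2norm_ge0 x.
apply/l2_leP; first by rewrite mulr_ge0 // addr_ge0 ?mulr_ge0 ?normc_ge0.
rewrite mulrDl -mulrA; apply: l2_leD; rewrite ?mulr_ge0 ?normc_ge0 //.
  by apply: l2_leZ; exact: l2_le_norm.
by apply: l2_leZ; apply/l2_leP; rewrite ?mulr_ge0.
Qed.

(** Linearity of the inverse comes for free from uniqueness of the solution, so
solvability with a norm bound and injectivity are all that must be checked. *)
Lemma l2invertibleI A c : bounded_op A ->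
  (forall x, l2 x -> A x = 0 -> x = 0) ->
  (forall v, l2 v -> exists y, [/\ l2 y, A y = v & l2norm y <= c * l2norm v]) ->
  l2invertible A.
Proof.
move=> hA inj sol.
have injA x y : l2 x -> l2 y -> A x = A y -> x = y.
  move=> hx hy e; apply/eqP; rewrite -subr_eq0; apply/eqP; apply: inj.
    exact: l2B.
  by rewrite addrC -scaleN1r (bounded_op_lin _ hA hy hx) e scaleN1r addNr.
pose B v := xget v [set y | [/\ l2 y, A y = v & l2norm y <= c * l2norm v]].
have BP v : l2 v -> [/\ l2 (B v), A (B v) = v & l2norm (B v) <= c * l2norm v].
  by move=> /sol; exact: xgetPex.
exists B; split=> //.
- split=> [a x y hx hy|]; last first.
    by exists c => v /BP[].
  have [hBx ABx _] := BP x hx; have [hBy ABy _] := BP y hy.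
  have hxy : l2 (a *: x + y) by apply: l2D => //; exact: l2Z.
  have [hBxy ABxy _] := BP _ hxy.
  apply: injA => //; first by apply: l2D => //; exact: l2Z.
  by rewrite [LHS]ABxy (bounded_op_lin a hA hBx hBy) ABx ABy.
- move=> x hx; have [_ ABx _] := BP x hx; split=> //.
  have [c' _ /(_ x hx)[hAx _]] := bounded_op_le hA.
  by have [hB AB _] := BP _ hAx; apply: injA.
Qed.

Lemma opinvP A : l2invertible A -> l2inverse A (opinv A).
Proof. exact: xgetPex. Qed.

End BoundedOperators.

(** * Operators whose coordinates are finite combinations *)

Section Finitary.
Context {R : realType} {I : choiceType}.
Implicit Types (x y : I -> R[i]) (A : (I -> R[i]) -> (I -> R[i])).

(** The operators of row-finite matrices.  They are linear on all families, not
only on l2, and continuous for coordinatewise convergence. *)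
Definition finitary A := forall i, exists (s : seq I) (w : I -> R[i]),
  forall x, A x i = \sum_(k <- s) w k * x k.

Lemma finitary_lin A (a : R[i]) x y : finitary A -> A (a *: x + y) = a *: A x + A y.
Proof.
move=> fA; apply/funext => i; have [s [w h]] := fA i.
rewrite [RHS](_ : _ = a * A x i + A y i) // !h mulr_sumr -big_split.
by apply: eq_bigr => k _; rewrite [(_ + _) k](_ : _ = a * x k + y k) // mulrDr mulrCA.
Qed.

Lemma finitary0 A : finitary A -> A 0 = 0.
Proof.
move=> fA; apply/funext => i; have [s [w ->]] := fA i.
by rewrite big1 // => k _; rewrite mulr0.
Qed.

Lemma finitaryD A x y : finitary A -> A (x + y) = A x + A y.
Proof. by move=> /(finitary_lin 1 x y); rewrite !scale1r. Qed.

Lemma finitaryZ A (a : R[i]) x : finitary A -> A (a *: x) = a *: A x.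
Proof. by move=> fA; have := finitary_lin a x 0 fA; rewrite !addr0 finitary0 // addr0. Qed.

Lemma finitary_sum A n (f : nat -> I -> R[i]) : finitary A ->
  A (\sum_(k < n) f k) = \sum_(k < n) A (f k).
Proof.
move=> fA; elim: n => [|n IH]; first by rewrite !big_ord0 finitary0.
by rewrite !big_ord_recr /= finitaryD ?IH.
Qed.

Lemma finitary_scale A (t : R[i]) : finitary A -> finitary (fun x => t *: A x).
Proof.
move=> fA i; have [s [w h]] := fA i; exists s, (fun k => t * w k) => x.
rewrite [LHS](_ : _ = t * A x i) // h mulr_sumr; apply: eq_bigr => k _.
by rewrite mulrA.
Qed.

Lemma iter_scale A (t : R[i]) n x : finitary A ->
  iter n (fun x => t *: A x) x = t ^+ n *: iter n A x.
Proof.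
move=> fA; elim: n => [|n IH]; first by rewrite scale1r.
by rewrite !iterS IH finitaryZ // scalerA exprS.
Qed.

(** Substituting x = y + A x into itself n times. *)
Lemma neumann_unroll A x y n : finitary A ->
  x - A x = y -> x = \sum_(k < n) iter k A y + iter n A x.
Proof.
move=> fA e; elim: n => [|n IH]; first by rewrite big_ord0 add0r.
have e' : x = A x + y by rewrite -e addrC subrK.
rewrite {1}e' {1}IH finitaryD // (finitary_sum _ _ fA) big_ord_recl /= addrAC.
by congr (_ + _); rewrite addrC.
Qed.

Lemma neumann_telescope A y n : finitary A ->
  \sum_(k < n) iter k A y - A (\sum_(k < n) iter k A y) = y - iter n A y.
Proof.
move=> fA; rewrite (finitary_sum _ _ fA); elim: n => [|n IH].
  by rewrite !big_ord0 subr0 subrr.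
by rewrite !big_ord_recr /= opprD addrACA IH addrA subrK.
Qed.

End Finitary.

(** * Coordinatewise limits and the Neumann series *)

Section Neumann.
Context {R : realType} {I : choiceType}.
Implicit Types (x y : I -> R[i]) (A : (I -> R[i]) -> (I -> R[i])) (c : R).

(** Convergence in the complex plane is reduced to the complete field R through
real and imaginary parts. *)
Definition ccvg (a : nat -> R[i]) (l : R[i]) :=
  (complex.Re (a n) @[n --> \oo] --> complex.Re l) /\
  (complex.Im (a n) @[n --> \oo] --> complex.Im l).

Lemma ccvg_cst l : ccvg (fun=> l) l.
Proof. by split; exact: cvg_cst. Qed.

Lemma ccvgD a b l m : ccvg a l -> ccvg b m -> ccvg (fun n => a n + b n) (l + m).
Proof.
move=> [a1 a2] [b1 b2]; split.
  rewrite (_ : (fun n => _) = (fun n => complex.Re (a n) + complex.Re (b n))).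
    rewrite (_ : complex.Re (l + m) = complex.Re l + complex.Re m); first exact: cvgD.
    by case: l m {a1 a2 b1 b2} => ? ? [].
  by apply/funext => n; case: (a n) (b n) => ? ? [].
rewrite (_ : (fun n => _) = (fun n => complex.Im (a n) + complex.Im (b n))).
  rewrite (_ : complex.Im (l + m) = complex.Im l + complex.Im m); first exact: cvgD.
  by case: l m {a1 a2 b1 b2} => ? ? [].
by apply/funext => n; case: (a n) (b n) => ? ? [].
Qed.

Lemma ccvgZ w a l : ccvg a l -> ccvg (fun n => w * a n) (w * l).
Proof.
move=> [a1 a2]; split.
  rewrite (_ : (fun n => _) = (fun n => complex.Re w * complex.Re (a n)
    - complex.Im w * complex.Im (a n))).
    rewrite (_ : complex.Re (w * l) = complex.Re w * complex.Re l
      - complex.Im w * complex.Im l); first by apply: cvgB; apply: cvgM => //; exact: cvg_cst.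
    by case: w l {a1 a2} => ? ? [].
  by apply/funext => n; case: w (a n) => ? ? [].
rewrite (_ : (fun n => _) = (fun n => complex.Re w * complex.Im (a n)
  + complex.Im w * complex.Re (a n))).
  rewrite (_ : complex.Im (w * l) = complex.Re w * complex.Im l
    + complex.Im w * complex.Re l); first by apply: cvgD; apply: cvgM => //; exact: cvg_cst.
  by case: w l {a1 a2} => ? ? [].
by apply/funext => n; case: w (a n) => ? ? [].
Qed.

Lemma ccvg_unique a l m : ccvg a l -> ccvg a m -> l = m.
Proof.
case: l m => [l1 l2'] [m1 m2] /= [a1 a2] [b1 b2].
by congr (_ +i* _)%C; [exact: (cvg_unique _ a1 b1)|exact: (cvg_unique _ a2 b2)].
Qed.

Lemma ccvg_shift a l : ccvg a l -> ccvg (fun n => a n.+1) l.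
Proof.
move=> [a1 a2]; split; first by rewrite (cvg_shiftS (fun n => complex.Re (a n))).
by rewrite (cvg_shiftS (fun n => complex.Im (a n))).
Qed.

Lemma ccvg_sum (s : seq I) (f : nat -> I -> R[i]) (g : I -> R[i]) :
  (forall i, ccvg (fun n => f n i) (g i)) ->
  ccvg (fun n => \sum_(i <- s) f n i) (\sum_(i <- s) g i).
Proof.
move=> h; elim: s => [|i s IH].
  rewrite big_nil (_ : (fun n => _) = fun=> 0); first exact: ccvg_cst.
  by apply/funext => n; rewrite big_nil.
rewrite big_cons (_ : (fun n => _) = fun n => f n i + \sum_(j <- s) f n j).
  exact: ccvgD.
by apply/funext => n; rewrite big_cons.
Qed.

Lemma ccvg_finitary A (f : nat -> I -> R[i]) (g : I -> R[i]) i : finitary A ->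
  (forall i, ccvg (fun n => f n i) (g i)) -> ccvg (fun n => A (f n) i) (A g i).
Proof.
move=> fA h; have [s [w e]] := fA i.
rewrite e (_ : (fun n => _) = fun n => \sum_(k <- s) w k * f n k).
  by apply: ccvg_sum => k; exact: ccvgZ.
by apply/funext => n; rewrite e.
Qed.

Lemma ccvg_sqr_normc a l : ccvg a l ->
  normc (a n) ^+ 2 @[n --> \oo] --> normc l ^+ 2.
Proof.
move=> [a1 a2]; rewrite sqr_normcE; under eq_fun do rewrite sqr_normcE !expr2.
by rewrite !expr2; apply: cvgD; exact: cvgM.
Qed.

(** Closed balls of l2 are closed for coordinatewise convergence (Fatou). *)
Lemma ccvg_l2_le (f : nat -> I -> R[i]) (g : I -> R[i]) c :
  (forall i, ccvg (fun n => f n i) (g i)) -> (forall n, l2_le (f n) c) -> l2_le g c.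
Proof.
move=> h le s us.
have cv : partial_sq (f n) s @[n --> \oo] --> partial_sq g s.
  rewrite /partial_sq; elim: s {us} => [|i s IH].
    by under eq_fun do rewrite big_nil; rewrite big_nil; exact: cvg_cst.
  under eq_fun do rewrite big_cons; rewrite big_cons; apply: cvgD => //.
  exact: ccvg_sqr_normc.
rewrite -(cvg_lim _ cv) //; apply: limr_le; first by apply/cvg_ex; eexists; exact: cv.
by apply: nearW => n; exact: le.
Qed.

Lemma ccvg_geometric (a : nat -> R[i]) c r : 0 <= r -> r < 1 ->
  (forall n, normc (a n) <= c * r ^+ n) ->
  exists l, ccvg (fun n => \sum_(k < n) a k) l.
Proof.
move=> r0 r1 le.
have cvs (b : R^nat) : (forall n, `|b n| <= normc (a n)) -> cvgn (series b).
  move=> hb; apply: normed_cvg.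
  have /(@is_cvg_geometric_series R c) : `|r| < 1 by rewrite ger0_norm.
  apply: series_le_cvg => n //=; rewrite /geometric.
  - by apply: le_trans (le n); exact: normc_ge0.
  - exact: le_trans (hb n) (le n).
have cr : cvgn (series (fun n => complex.Re (a n))) by apply: cvs => n; exact: ler_Re_normc.
have ci : cvgn (series (fun n => complex.Im (a n))) by apply: cvs => n; exact: ler_Im_normc.
exists (limn (series (fun n => complex.Re (a n))) +i* limn (series (fun n => complex.Im (a n))))%C.
split => /=.
  rewrite (_ : (fun n => _) = series (fun n => complex.Re (a n))) //.
  apply/funext => n; rewrite /series /= big_mkord.
  elim: n {cr ci} => [|n IH]; rewrite ?big_ord0 // !big_ord_recr /= -IH.
  by case: (\sum_(_ < n) _) (a n) => ? ? [].
rewrite (_ : (fun n => _) = series (fun n => complex.Im (a n))) //.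
apply/funext => n; rewrite /series /= big_mkord.
elim: n {cr ci} => [|n IH]; rewrite ?big_ord0 // !big_ord_recr /= -IH.
by case: (\sum_(_ < n) _) (a n) => ? ? [].
Qed.

(** The Neumann series converges coordinatewise because its n-th term has norm at
most r^n ||v||.  Its partial sums S satisfy S (n + 1) = v + A (S n): this bounds
them by ||v|| / (1 - r), and at the limit it becomes y = v + A y, A being
continuous for coordinatewise limits. *)
Lemma neumann_solution A r v : finitary A -> 0 <= r -> r < 1 ->
  (forall x, l2 x -> l2 (A x) /\ l2norm (A x) <= r * l2norm x) -> l2 v ->
  exists y, [/\ l2 y, y - A y = v & l2norm y <= (1 - r)^-1 * l2norm v].
Proof.
move=> fA r0 r1 hA hv; set N := l2norm v; have N0 : 0 <= N by exact: l2norm_ge0.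
have s0 : 0 < 1 - r by rewrite subr_gt0.
have Ale x c : 0 <= c -> l2_le x c -> l2_le (A x) (r * c).
  move=> c0 /(l2_leP _ c0)[hx le]; have [h1 h2] := hA x hx.
  by apply/l2_leP; rewrite ?mulr_ge0 //; split=> //; apply: le_trans h2 _; rewrite ler_wpM2l.
pose S n := \sum_(k < n) iter k A v.
have SS n : S n.+1 = v + A (S n) by rewrite /S (finitary_sum _ _ fA) big_ord_recl.
have Sle n : l2_le (S n) ((1 - r)^-1 * N).
  elim: n => [|n IH]; first by rewrite /S big_ord0; exact: l2_le0.
  have b0 : 0 <= (1 - r)^-1 * N by rewrite mulr_ge0 // invr_ge0 ltW.
  rewrite SS (_ : _ * N = N + r * ((1 - r)^-1 * N)); last by field; rewrite gt_eqF.
  by apply: l2_leD => //; [exact: mulr_ge0|exact: l2_le_norm|exact: Ale].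
have itle n : l2_le (iter n A v) (N * r ^+ n).
  elim: n => [|n IH]; first by rewrite expr0 mulr1; exact: l2_le_norm.
  by rewrite iterS exprS mulrCA; apply: Ale => //; rewrite mulr_ge0 ?exprn_ge0.
have lim i : exists l, ccvg (fun n => S n i) l.
  have [l hl] := @ccvg_geometric (fun n => iter n A v i) N r r0 r1
    (fun n => l2_le_coord i (mulr_ge0 N0 (exprn_ge0 _ r0)) (itle n)).
  exists l; rewrite (_ : (fun n => _) = (fun n => \sum_(k < n) iter k A v i)) //.
  by apply/funext => n; rewrite /S fct_sumE.
have [y hy] := choice lim.
have /l2_leP[|ly ny] := ccvg_l2_le hy Sle; first by rewrite mulr_ge0 // invr_ge0 ltW.
exists y; split=> //; apply/funext => i.
have e : y i = v i + A y i.
  apply: (ccvg_unique (ccvg_shift (hy i))).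
  rewrite (_ : (fun n => _) = fun n => v i + A (S n) i).
    by apply: ccvgD; [exact: ccvg_cst|exact: ccvg_finitary].
  by apply/funext => n; rewrite SS.
by rewrite [LHS](_ : _ = y i - A y i) // {1}e addrK.
Qed.

Lemma contraction_fix0 A r x : r < 1 ->
  (forall x, l2 x -> l2norm (A x) <= r * l2norm x) -> l2 x -> x = A x -> x = 0.
Proof.
move=> r1 hA hx e; apply: l2norm_eq0 => //.
have := hA x hx; rewrite -e => le.
by have := l2norm_ge0 x; nra.
Qed.

End Neumann.

(** * Row-finite infinite matrices *)

Section RowFinite.
Context {R : realType} {I : choiceType}.
Implicit Types (A B : I -> I -> R[i]) (x : I -> R[i]).

Definition row_support (a : I -> R[i]) (s : seq I) :=
  uniq s /\ forall k, k \notin s -> a k = 0.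

Definition row_finite A := forall i, exists s, row_support (A i) s.

Lemma fsum_row_support (a : I -> R[i]) (f : I -> R[i]) s : row_support a s ->
  \sum_(k \in [set: I]) (a k * f k) = \sum_(k <- s) a k * f k.
Proof.
move=> [us hs]; rewrite (fsbig_seq _ _ us); apply/esym; apply: fsbig_widen => //.
by move=> k [_ /= /negP/hs ->]; rewrite mul0r.
Qed.

Lemma finitary_imop A : row_finite A -> finitary (imop A).
Proof.
move=> fA i; have [s hs] := fA i.
by exists s, (A i) => x; rewrite /imop (fsum_row_support _ hs).
Qed.

(** The support t of row i of A B is chosen large enough to carry also every row
of B that enters it, so that the double sum giving (A B) x can be exchanged. *)
Lemma immul_row_support A B i : row_finite A -> row_finite B ->
  exists s t, [/\ row_support (A i) s, row_support (immul A B i) t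
    & forall k, k \in s -> row_support (B k) t].
Proof.
move=> fA fB; have [s hs] := fA i; have [g hg] := choice fB.
exists s, (undup (flatten (map g s))); split=> //; last first.
  move=> k ks; split; first exact: undup_uniq.
  move=> j; rewrite mem_undup => jn; apply: (hg k).2.
  by apply: contra jn => jg; apply/flatten_mapP; exists k.
split; first exact: undup_uniq.
move=> j; rewrite mem_undup => jn; rewrite /immul (fsum_row_support _ hs).
apply: big1_seq => k /= ks; rewrite (hg k).2 ?mulr0 //.
by apply: contra jn => jg; apply/flatten_mapP; exists k.
Qed.

Lemma row_finite_immul A B : row_finite A -> row_finite B -> row_finite (immul A B).
Proof. by move=> fA fB i; have [s [t [_ ht _]]] := immul_row_support i fA fB; exists t. Qed.

Lemma imop_immul A B x : row_finite A -> row_finite B ->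
  imop (immul A B) x = imop A (imop B x).
Proof.
move=> fA fB; apply/funext => i; have [s [t [hs ht hB]]] := immul_row_support i fA fB.
rewrite /imop (fsum_row_support _ ht) (fsum_row_support _ hs).
under eq_bigr => j _ do rewrite /immul (fsum_row_support _ hs) mulr_suml.
rewrite exchange_big /=; apply: eq_big_seq => k ks.
by rewrite (fsum_row_support _ (hB k ks)) mulr_sumr; apply: eq_bigr => j _; rewrite mulrA.
Qed.

Lemma row_support_imid i : row_support (imid (R := R) i) [:: i].
Proof. by split=> // k; rewrite inE eq_sym /imid => /negbTE ->. Qed.

Lemma imop_imid x : imop imid x = x.
Proof.
apply/funext => i; rewrite /imop (fsum_row_support _ (row_support_imid i)).
by rewrite big_seq1 /imid eqxx mul1r.
Qed.

Lemma row_finite_imid : row_finite imid.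
Proof. by move=> i; exists [:: i]; exact: row_support_imid. Qed.

Lemma row_finite_big_immul k (G : 'I_k -> I -> I -> R[i]) :
  (forall a, row_finite (G a)) -> row_finite (\big[immul/imid]_(a < k) G a).
Proof.
move=> fG; elim/big_rec: _ => [|a M _ fM]; first exact: row_finite_imid.
exact: row_finite_immul.
Qed.

(** Since [immul] is not associative on arbitrary matrices, the product of the G a is
described by the chain of families f through which it acts. *)
Lemma imop_big_immul k (G : 'I_k -> I -> I -> R[i]) (f : nat -> I -> R[i]) :
  (forall a, row_finite (G a)) -> (forall a : 'I_k, f a = imop (G a) (f a.+1)) ->
  f 0%N = imop (\big[immul/imid]_(a < k) G a) (f k).
Proof.
elim: k G f => [|k IH] G f fG hf; first by rewrite big_ord0 imop_imid.
rewrite big_ord_recl imop_immul //; last exact: row_finite_big_immul.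
rewrite (hf ord0); congr imop.
apply: (IH (fun a => G (lift ord0 a)) (fun n => f n.+1)) => a; first exact: fG.
exact: (hf (lift ord0 a)).
Qed.

End RowFinite.

(** * Bidiagonal factors *)

Section Bidiagonal.
Context {R : realType}.

Lemma row_finite_lower_bidiag (l : nat -> R[i]) : row_finite (lower_bidiag l).
Proof.
move=> n; exists (iota 0 n.+2); split=> [|k]; first exact: iota_uniq.
by rewrite mem_iota /lower_bidiag => h; rewrite !ifN //; lia.
Qed.

Lemma row_finite_upper_bidiag (v : nat -> R[i]) : row_finite (upper_bidiag v).
Proof.
move=> n; exists (iota 0 n.+2); split=> [|k]; first exact: iota_uniq.
by rewrite mem_iota /upper_bidiag => h; rewrite !ifN //; lia.
Qed.

Lemma row_finite_lower_factors p (ell : 'I_p -> nat -> R[i]) :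
  row_finite (\big[immul/imid]_(a < p) lower_bidiag (ell a)).
Proof. by apply: row_finite_big_immul => a; exact: row_finite_lower_bidiag. Qed.

Lemma row_finite_upper_factors q (u : 'I_q -> nat -> R[i]) :
  row_finite (\big[immul/imid]_(b < q) upper_bidiag (u (rev_ord b))).
Proof. by apply: row_finite_big_immul => b; exact: row_finite_upper_bidiag. Qed.

Lemma finitary_bidiag_product p q (ell : 'I_p -> nat -> R[i])
  (u : 'I_q -> nat -> R[i]) : finitary (imop (bidiag_product ell u)).
Proof.
apply: finitary_imop; apply: row_finite_immul.
  exact: row_finite_lower_factors.
exact: row_finite_upper_factors.
Qed.

End Bidiagonal.

(** * Height indices as pairs of a component and a rank *)

Section HeightIndex.
Variables p q : nat.

Lemma mul_redQ : (p * redQ p q = q * redP p q)%N.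
Proof. by rewrite !muln_divA ?dvdn_gcdl ?dvdn_gcdr // mulnC. Qed.

(** At the last lower factor the next offset is that of the first upper factor, and
the two formulas agree by [mul_redQ]. *)
Lemma offset_ordS_lower (q_gt0 : (0 < q)%N) (j : 'I_(p + q)) a :
  fintype.split j = inl a ->
  offset (ordS j) = (offset j + redQ p q)%N.
Proof.
move=> e; have -> : offset j = (a * redQ p q)%N by rewrite /offset e.
have ja : j = a :> nat by rewrite -[j]splitK e.
have jS : ordS j = a.+1 :> nat by rewrite /= ja modn_small //; have := ltn_ord a; lia.
have -> : (a * redQ p q + redQ p q = a.+1 * redQ p q)%N by rewrite mulSn addnC.
rewrite /offset; case: splitP => [a' <-|b eb]; first by rewrite jS.
have ap : (a.+1 = p)%N by have := ltn_ord a; lia.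
have -> : (b = 0 :> nat)%N by lia.
by rewrite subn0 -mul_redQ ap.
Qed.

Lemma offset_ordS_upper (p_gt0 : (0 < p)%N) (j : 'I_(p + q)) b :
  fintype.split j = inr b ->
  offset j = (offset (ordS j) + redP p q)%N.
Proof.
move=> e; have -> : offset j = ((q - b) * redP p q)%N by rewrite /offset e.
have jb : j = (p + b)%N :> nat by rewrite -[j]splitK e.
have bq := ltn_ord b.
have [bl|bl] := ltnP b.+1 q.
  have jS : ordS j = (p + b.+1)%N :> nat by rewrite /= jb modn_small; lia.
  rewrite /offset; case: splitP => [a ea|b' eb]; first by have := ltn_ord a; lia.
  have -> : (b' = b.+1 :> nat)%N by lia.
  by rewrite -mulSnr -subSn // subSS.
have jS : ordS j = 0%N :> nat by rewrite /= jb -addnS (_ : b.+1 = q) ?modnn; lia.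
rewrite /offset; case: splitP => [a ea|b' eb]; last by lia.
have -> : (a = 0 :> nat)%N by lia.
by rewrite mul0n (_ : q - b = 1)%N ?mul1n //; lia.
Qed.

Lemma is_height_index_offset (j : 'I_(p + q)) n :
  is_height_index ((offset j + n * redR p q)%N, j).
Proof. by rewrite /is_height_index /= leq_addr addKn dvdn_mull. Qed.

Definition component_index (j : 'I_(p + q)) n : height_index p q :=
  exist (fun x => is_height_index x) _ (is_height_index_offset j n).

Lemma component_index_rank x : component_index (val x).2 (height_rank x) = x.
Proof.
apply: val_inj; case: x => [[h j] /= hx]; have /andP[/= le dv] := hx.
by rewrite /height_rank /= divnK // subnKC.
Qed.

Hypothesis p_gt0 : (0 < p)%N.

Lemma redR_gt0 : (0 < redR p q)%N.
Proof.
rewrite addn_gt0 (_ : 0 < redP p q)%N // divn_gt0 ?gcdn_gt0 ?p_gt0 //.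
by rewrite dvdn_leq ?dvdn_gcdl.
Qed.

Lemma height_rank_component_index j n : height_rank (component_index j n) = n.
Proof. by rewrite /height_rank /= addKn mulnK // redR_gt0. Qed.

Lemma component_index_inj j : injective (component_index j).
Proof. by move=> n m /(congr1 (@height_rank p q)); rewrite !height_rank_component_index. Qed.

Lemma height_firstE n : height_first q p_gt0 n = component_index (first_ord q p_gt0) n.
Proof.
apply: val_inj => /=; congr pair; rewrite /offset.
case: splitP => [a /= <-|b /= eb]; first by rewrite mul0n.
by lia.
Qed.

End HeightIndex.

(** * The height matrix as a block-cyclic matrix *)

Section HeightMatrix.
Context {R : realType} {p q : nat} (p_gt0 : (0 < p)%N) (q_gt0 : (0 < q)%N).
Variables (ell : 'I_p -> nat -> R[i]) (u : 'I_q -> nat -> R[i]).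

Definition stage (j : 'I_(p + q)) : nat -> nat -> R[i] :=
  match fintype.split j with
  | inl a => lower_bidiag (ell a)
  | inr b => upper_bidiag (u (rev_ord b))
  end.

Lemma row_finite_stage j : row_finite (stage j).
Proof.
by rewrite /stage; case: (fintype.split j) => a;
  [exact: row_finite_lower_bidiag|exact: row_finite_upper_bidiag].
Qed.

(** With h = offset j + n R and h' = offset (j + 1) + n' R, a step h' = h + Q reads
n' = n at a lower factor and n' = n + 1 at an upper one, a step h' = h - P reads
n' = n - 1, respectively n' = n: these are the entries of the bidiagonal factor. *)
Lemma height_matrix_component_index j n j' n' :
  height_matrix ell u (component_index j n) (component_index j' n')
  = if j' == ordS j then stage j n n' else 0.
Proof.
rewrite /height_matrix /=; case: eqVneq => //= ->.
have R0 : (0 < redR p q)%N by exact: redR_gt0.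
have RE : redR p q = (redP p q + redQ p q)%N by [].
rewrite /stage /height_weight /= height_rank_component_index //.
case e : (fintype.split j) => [a|b].
  have os : offset (ordS j) = (offset j + redQ p q)%N by exact: (offset_ordS_lower q_gt0 e).
  have -> : (offset (ordS j) + n' * redR p q == offset j + n * redR p q + redQ p q)%N = (n == n').
    by rewrite os addnAC eqn_add2r eqn_add2l eqn_pmul2r // eq_sym.
  have -> : (offset (ordS j) + n' * redR p q + redP p q
      == offset j + n * redR p q)%N = (n == n'.+1).
    rewrite os -!addnA eqn_add2l addnCA [(redQ p q + _)%N]addnC -RE -mulSnr.
    by rewrite eqn_pmul2r // eq_sym.
  rewrite /lower_bidiag; case: eqVneq => // _; case: eqVneq => // ->; by [].
have os : offset j = (offset (ordS j) + redP p q)%N by exact: (offset_ordS_upper p_gt0 e).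
have -> : (offset (ordS j) + n' * redR p q == offset j + n * redR p q + redQ p q)%N = (n' == n.+1).
  rewrite os -!addnA eqn_add2l addnCA -RE -mulSnr.
  by rewrite eqn_pmul2r // eq_sym.
have -> : (offset (ordS j) + n' * redR p q + redP p q == offset j + n * redR p q)%N = (n == n').
  by rewrite os addnAC eqn_add2l eqn_pmul2r // eq_sym.
rewrite /upper_bidiag; case: (eqVneq n n') => [->|//].
by rewrite ltn_eqF.
Qed.

Lemma row_support_height j n s : row_support (stage j n) s ->
  row_support (height_matrix ell u (component_index j n))
    [seq component_index (ordS j) m | m <- s].
Proof.
move=> [us s0]; split; first by rewrite map_inj_uniq //; exact: component_index_inj.
move=> y; rewrite -(component_index_rank y) height_matrix_component_index.
case: eqVneq => // ->; rewrite mem_map; last exact: component_index_inj.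
exact: s0.
Qed.

Lemma component_imop_height y j :
  imop (height_matrix ell u) y \o component_index j
  = imop (stage j) (y \o component_index (ordS j)).
Proof.
apply/funext => n /=; have [s hs] := row_finite_stage j n; have [us s0] := hs.
rewrite /imop (fsum_row_support _ hs).
have ht := row_support_height hs.
rewrite (fsum_row_support _ ht) big_map; apply: eq_bigr => m _.
by rewrite height_matrix_component_index eqxx.
Qed.

Lemma finitary_height : finitary (imop (height_matrix ell u)).
Proof.
apply: finitary_imop => x; rewrite -(component_index_rank x).
have [s hs] := row_finite_stage (val x).2 (height_rank x).
by eexists; exact: row_support_height hs.
Qed.

End HeightMatrix.

Lemma coord_projT_delta {R : realType} (I : choiceType) n (f : 'I_n -> I) (l : 'I_n) :
  coord_projT f (delta_mx l 0 : 'cV[R[i]]_n) = fun i => (f l == i)%:R.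
Proof.
apply/funext => i; rewrite /coord_projT; under eq_bigr do rewrite mxE eqxx andbT.
case: eqVneq => [<-|ne].
  rewrite (bigD1 l) //= eqxx big1 ?addr0 // => k /andP[_ /negbTE ->] //.
by rewrite big1 // => k /eqP fk; case: eqVneq => // kl; rewrite -kl fk eqxx in ne.
Qed.

(** * Going around the cycle *)

Section HeightCycle.
Context {R : realType} {p q : nat} (p_gt0 : (0 < p)%N) (q_gt0 : (0 < q)%N).
Variables (ell : 'I_p -> nat -> R[i]) (u : 'I_q -> nat -> R[i]).
Local Notation M := (p + q)%N.
Local Notation H := (imop (height_matrix ell u)).
Local Notation T := (imop (bidiag_product ell u)).
Local Notation j0 := (first_ord q p_gt0).

Definition first_component (y : height_index p q -> R[i]) : nat -> R[i] :=
  y \o component_index j0.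

Definition from_first (x : nat -> R[i]) : height_index p q -> R[i] :=
  fun y => if (val y).2 == j0 then x (height_rank y) else 0.

Lemma from_first_component_index x j :
  from_first x \o component_index j = if j == j0 then x else 0.
Proof.
by apply/funext => n; rewrite /from_first /= height_rank_component_index //; case: ifP.
Qed.

Lemma from_firstK : cancel from_first first_component.
Proof. by move=> x; rewrite /first_component from_first_component_index eqxx. Qed.

Lemma l2_le_first_component y c : l2_le y c -> l2_le (first_component y) c.
Proof. by apply: l2_le_comp; exact: component_index_inj. Qed.

Lemma l2_le_from_first x c : l2_le x c -> l2_le (from_first x) c.
Proof.
move=> hx; apply: (@l2_le_extend _ _ _ (component_index j0) (@height_rank p q)).
  move=> y; rewrite /from_first; case: (eqVneq (val y).2 j0) => // <-.
  by rewrite component_index_rank eqxx.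
by rewrite -/(first_component _) from_firstK.
Qed.

Lemma height_index_ext (y y' : height_index p q -> R[i]) :
  (forall j, y \o component_index j = y' \o component_index j) -> y = y'.
Proof.
move=> h; apply/funext => i; rewrite -(component_index_rank i).
exact: (congr1 (fun g => g (height_rank i)) (h (val i).2)).
Qed.

Lemma M_gt0 : (0 < M)%N. Proof. by rewrite addn_gt0 p_gt0. Qed.

Definition cyclic_ord (n : nat) : 'I_M := Ordinal (ltn_pmod n M_gt0).

Lemma ordS_cyclic_ord n : ordS (cyclic_ord n) = cyclic_ord n.+1.
Proof. by apply: val_inj; rewrite /= -addn1 modnDml addn1. Qed.

Lemma first_component_cycle y : first_component (iter M H y) = T (first_component y).
Proof.
(* f n is the state after the factors from the n-th one on have acted. *)
pose f n := iter (M - n) H y \o component_index (cyclic_ord n).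
have fS n : (n < M)%N -> f n = imop (stage ell u (cyclic_ord n)) (f n.+1).
  by move=> nM; rewrite /f -[(M - n)%N]subSS subSn // iterS
    component_imop_height // ordS_cyclic_ord.
have f0 : f 0%N = first_component (iter M H y).
  rewrite /f subn0 /first_component; congr (_ \o component_index _).
  by apply: val_inj; rewrite /= mod0n.
have fM : f M = first_component y.
  rewrite /f subnn /first_component; congr (_ \o component_index _).
  by apply: val_inj; rewrite /= modnn.
rewrite -f0 -fM /bidiag_product imop_immul; first last.
- exact: row_finite_upper_factors.
- exact: row_finite_lower_factors.
rewrite -(imop_big_immul (f := fun n => f (p + n)%N)); first last.
- move=> b; rewrite /= addnS fS ?ltn_add2l // /stage; congr (imop _ _).
  have -> : cyclic_ord (p + b) = rshift p b.
    by apply: val_inj; rewrite /= modn_small // ltn_add2l.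
  by rewrite (unsplitK (inr b)).
- by move=> b; exact: row_finite_upper_bidiag.
rewrite addn0; apply: imop_big_immul => a; first exact: row_finite_lower_bidiag.
have aM : (a < M)%N by rewrite (leq_trans (ltn_ord a)) // leq_addr.
rewrite fS // /stage; congr (imop _ _).
have -> : cyclic_ord a = lshift q a by apply: val_inj; rewrite /= modn_small.
by rewrite (unsplitK (inl a)).
Qed.

(** H^n moves the support from component 0 to component -n modulo M. *)
Lemma iter_height_off x n (j : 'I_M) : ((j + n) %% M != 0)%N ->
  iter n H (from_first x) \o component_index j = 0.
Proof.
elim: n j => [|n IH] j.
  by rewrite from_first_component_index; case: (eqVneq j j0) => // ->; rewrite addn0 mod0n.
move=> h; rewrite iterS component_imop_height // IH ?finitary0 //.
  by apply: finitary_imop; exact: row_finite_stage.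
by rewrite /= modnDml addSn -addnS.
Qed.

Lemma iter_height_from_first x : iter M H (from_first x) = from_first (T x).
Proof.
apply: height_index_ext => j; rewrite from_first_component_index; case: eqVneq => [->|jn].
  by have := first_component_cycle (from_first x); rewrite from_firstK.
apply: iter_height_off; rewrite modnDr modn_small //.
Qed.

Variable tau : R[i].
Local Notation K := (fun y => tau *: H y).

Lemma finitary_scaled_height : finitary K.
Proof. by apply: finitary_scale; exact: finitary_height. Qed.

Lemma first_component_partial_sum x :
  first_component (\sum_(n < M) iter n K (from_first x)) = x.
Proof.
apply/funext => n; rewrite /first_component /= fct_sumE (bigD1 (cyclic_ord 0)) //= mod0n.
rewrite big1 ?addr0 => [|k kn0].
  exact: (congr1 (fun g => g n) (from_firstK x)).
rewrite iter_scale; last exact: finitary_height.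
have off := @iter_height_off x k j0.
rewrite [LHS](_ : _ = tau ^+ k * (iter k H (from_first x) \o component_index j0) n) //.
rewrite off ?mulr0 //=.
by rewrite add0n modn_small //; move: kn0; rewrite -val_eqE /= mod0n.
Qed.

(** Only the terms n = 0 and n = M of the unrolled equation reach the first
component. *)
Lemma first_component_feedback y v : y - K y = from_first v ->
  first_component y = v + tau ^+ M *: T (first_component y).
Proof.
move=> /(neumann_unroll M finitary_scaled_height) {1}->.
rewrite [LHS](_ : _ = first_component (\sum_(n < M) iter n K (from_first v))
  + first_component (iter M K y)) //.
rewrite first_component_partial_sum; congr (_ + _).
rewrite iter_scale; last exact: finitary_height.
by rewrite -first_component_cycle.
Qed.

(** * Resolvents *)

Hypothesis H_bounded : bounded_op H.
Hypothesis tau_small : normc tau < (opnorm H)^-1.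
Local Notation r := (normc tau * opnorm H).

Lemma opnorm_gt0 : 0 < opnorm H.
Proof. by rewrite -invr_gt0 (le_lt_trans _ tau_small) ?normc_ge0. Qed.

Lemma ratio_ge0 : 0 <= r.
Proof. by rewrite mulr_ge0 ?normc_ge0 ?(ltW opnorm_gt0). Qed.

Lemma ratio_lt1 : r < 1.
Proof. by rewrite -ltr_pdivlMr ?opnorm_gt0 // div1r. Qed.

Lemma scaled_height_contraction y : l2 y -> l2 (K y) /\ l2norm (K y) <= r * l2norm y.
Proof.
move=> hy; have [c _ hc] := bounded_op_le H_bounded.
apply/l2_leP; first by rewrite mulr_ge0 ?l2norm_ge0 ?ratio_ge0.
rewrite -mulrA; apply: l2_leZ; apply/l2_leP.
  by rewrite mulr_ge0 ?l2norm_ge0 ?(ltW opnorm_gt0).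
by split; [exact: (hc y hy).1|exact: opnorm_le].
Qed.

Lemma resolvent_height : l2invertible (fun y i => y i - tau * H y i).
Proof.
apply: (@l2invertibleI _ _ _ (1 - r)^-1).
- have := bounded_op_affine 1 (- tau) H_bounded; congr bounded_op.
  by apply/funext => y; rewrite scale1r scaleNr.
- move=> y hy /(congr1 (fun g => g + K y)) e.
  apply: (contraction_fix0 ratio_lt1 (fun x hx => (scaled_height_contraction hx).2) hy).
  by move: e; rewrite [LHS]subrK add0r.
- move=> v hv; apply: (neumann_solution finitary_scaled_height ratio_ge0 ratio_lt1) => //.
  exact: scaled_height_contraction.
Qed.

(** T is the compression of H^M to the first component. *)
Lemma bounded_bidiag_product : bounded_op T.
Proof.
have fT : finitary T by exact: finitary_bidiag_product.
split=> [a x y _ _|]; first exact: finitary_lin.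
exists (opnorm H ^+ M) => x hx; have o0 := ltW opnorm_gt0.
have [c _ hc] := bounded_op_le H_bounded.
apply/l2_leP; first by rewrite mulr_ge0 ?l2norm_ge0 ?exprn_ge0.
rewrite -(from_firstK x) -first_component_cycle from_firstK; apply: l2_le_first_component.
suff le n : l2_le (iter n H (from_first x)) (opnorm H ^+ n * l2norm x) by exact: le.
elim: n => [|n IH]; first by rewrite expr0 mul1r /=; apply: l2_le_from_first; exact: l2_le_norm.
have b0 : 0 <= opnorm H ^+ n * l2norm x by rewrite mulr_ge0 ?exprn_ge0 ?l2norm_ge0.
move/(l2_leP _ b0): IH => [h1 h2]; rewrite exprS -mulrA iterS.
apply/l2_leP; first by rewrite mulr_ge0.
split; first exact: (hc _ h1).1.
by apply: le_trans (opnorm_le H_bounded h1) _; rewrite ler_wpM2l.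
Qed.

Variable z : R[i].
Hypothesis z_neq0 : z != 0.
Hypothesis z_tau : z^-1 = tau ^+ M.

(** If x = tau^M T x, the truncated Neumann series of x telescopes to a fixed point
of the contraction tau H whose first component is x. *)
Lemma bidiag_product_resolvent_inj x : l2 x -> z *: x - T x = 0 -> x = 0.
Proof.
move=> hx /(congr1 (fun g => z^-1 *: (g + T x))).
rewrite subrK add0r scalerA mulVf // scale1r z_tau => e.
rewrite -(first_component_partial_sum x).
set w := \sum_(k < M) _.
suff -> : w = 0 by [].
have lw : l2 w.
  suff lws n : l2 (\sum_(k < n) iter k K (from_first x)) by exact: lws.
  elim: n => [|n IH]; first by rewrite big_ord0; exact: l2_0.
  rewrite big_ord_recr /=; apply: l2D => //.
  elim: n {IH} => [|n IH]; last by apply: (scaled_height_contraction IH).1.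
  by have /l2_leP[] := l2_le_from_first (l2_le_norm hx); rewrite ?l2norm_ge0.
apply: (contraction_fix0 ratio_lt1 (fun x hx => (scaled_height_contraction hx).2) lw).
apply/eqP; rewrite -subr_eq0; apply/eqP.
rewrite [LHS](neumann_telescope _ M finitary_scaled_height).
rewrite iter_scale; last exact: finitary_height.
rewrite iter_height_from_first {1}e; apply/eqP; rewrite subr_eq0; apply/eqP/funext => i.
rewrite [RHS](_ : _ = tau ^+ M * from_first (T x) i) // /from_first.
by case: ifP => _; rewrite ?mulr0.
Qed.

Lemma bidiag_product_resolvent_sol v y : y - K y = from_first v ->
  z *: (z^-1 *: first_component y) - T (z^-1 *: first_component y) = v.
Proof.
move=> /first_component_feedback e.
have fT : finitary T by exact: finitary_bidiag_product.
by rewrite scalerA mulfV // scale1r finitaryZ // z_tau {1}e addrK.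
Qed.

Lemma resolvent_bidiag_product : resolvent_set T z.
Proof.
rewrite /resolvent_set /=; apply: (@l2invertibleI _ _ _ (normc z^-1 * (1 - r)^-1)).
- have := bounded_op_affine z (- 1) bounded_bidiag_product; congr bounded_op.
  by apply/funext => y; rewrite scaleN1r.
- exact: bidiag_product_resolvent_inj.
- move=> v hv; have hJ := l2_le_from_first (l2_le_norm hv).
  have [lJ nJ] := (l2_leP _ (l2norm_ge0 v)).1 hJ.
  have [y [ly ey ny]] := neumann_solution finitary_scaled_height ratio_ge0 ratio_lt1
    (fun x hx => scaled_height_contraction hx) lJ.
  have s0 : 0 <= (1 - r)^-1 by rewrite invr_ge0 subr_ge0 (ltW ratio_lt1).
  have /l2_leP[] : l2_le (z^-1 *: first_component y) (normc z^-1 * ((1 - r)^-1 * l2norm v)).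
  + apply: l2_leZ; apply: l2_le_first_component; apply/l2_leP.
      by rewrite mulr_ge0 ?l2norm_ge0.
    by split=> //; apply: le_trans ny _; rewrite ler_wpM2l.
  + by rewrite !mulr_ge0 ?normc_ge0 ?l2norm_ge0.
  move=> lx nx; exists (z^-1 *: first_component y); split=> //; last by rewrite -mulrA.
  exact: bidiag_product_resolvent_sol.
Qed.

(** * Weyl matrices *)

(** If y = (I - tau H)^-1 v with v supported on component 0, then z^-1 y_0 solves
(z I - T) x = v_0 and the left inverse property of (z I - T)^-1 identifies x. *)
Lemma compression_resolvent :
  compression (fun k : 'I_q => k : nat) (opinv (fun x n => z * x n - T x n))
    (fun k : 'I_p => k : nat)
  = z^-1 *: compression (fun k : 'I_q => height_first q p_gt0 k)
      (opinv (fun y i => y i - tau * H y i)) (fun k : 'I_p => height_first q p_gt0 k).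
Proof.
have hT := opinvP resolvent_bidiag_product; have hH := opinvP resolvent_height.
set RT := opinv _ in hT *; set RH := opinv _ in hH *.
apply/matrixP => k l; rewrite !mxE !coord_projT_delta.
set v : nat -> R[i] := fun i => _.
have lv : l2 v by exact: l2_unit.
have -> : (fun i => (height_first q p_gt0 l == i)%:R : R[i]) = from_first v.
  apply: height_index_ext => j; rewrite from_first_component_index; apply/funext => n /=.
  rewrite height_firstE //; case: (eqVneq j j0) => [->|ne].
    by rewrite (inj_eq (@component_index_inj _ _ p_gt0 j0)).
  by case: eqP => // /(congr1 (fun i => (val i).2)) /= e; rewrite e eqxx in ne.
have lJ : l2 (from_first v).
  by have /l2_leP[] := l2_le_from_first (l2_le_norm lv); rewrite ?l2norm_ge0.
have [_ [_ [cH hcH]] /(_ _ lJ) [_ eH]] := hH.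
have lRH := (hcH _ lJ).1.
have e : z^-1 *: first_component (RH (from_first v)) = RT v.
  have lf : l2 (z^-1 *: first_component (RH (from_first v))).
    apply: l2Z; have /l2_leP[] := l2_le_first_component (l2_le_norm lRH) => //.
    exact: l2norm_ge0.
  have [_ _ /(_ _ lf) [<- _]] := hT.
  by congr RT; exact: bidiag_product_resolvent_sol eH.
rewrite -e [LHS](_ : _ = z^-1 * RH (from_first v) (component_index j0 k)) //.
by rewrite -height_firstE //.
Qed.

End HeightCycle.

Theorem theorem5p7 (R : realType) (p q : nat) (p_gt0 : (0 < p)%N) (q_gt0 : (0 < q)%N)
    (ell : 'I_p -> nat -> R[i]) (u : 'I_q -> nat -> R[i])
    (xi : 'M[R[i]]_q) (nu : 'M[R[i]]_p)
    (xi_unit : xi \in unitmx) (nu_unit : nu \in unitmx)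
    (H_bounded : bounded_op (imop (height_matrix ell u)))
    (z tau : R[i]) (z_neq0 : z != 0) (z_tau : z^-1 = tau ^+ (p + q))
    (tau_small : normc tau < (opnorm (imop (height_matrix ell u)))^-1) :
  [/\ resolvent_set (imop (bidiag_product ell u)) z,
      l2invertible (fun x i => x i - tau * imop (height_matrix ell u) x i),
      weyl_matrix ell u xi nu z = height_weyl_matrix p_gt0 ell u xi nu z tau
    & forall tau' : R[i], z^-1 = tau' ^+ (p + q) ->
        height_weyl_matrix p_gt0 ell u xi nu z tau'
        = height_weyl_matrix p_gt0 ell u xi nu z tau].
Proof.
have weylE t : z^-1 = t ^+ (p + q) ->
    normc t < (opnorm (imop (height_matrix ell u)))^-1 ->
    weyl_matrix ell u xi nu z = height_weyl_matrix p_gt0 ell u xi nu z t.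
  move=> zt t_small; rewrite /weyl_matrix /height_weyl_matrix.
  by rewrite (compression_resolvent p_gt0 q_gt0 H_bounded t_small) // -scalemxAr -scalemxAl.
split.
- exact: (resolvent_bidiag_product p_gt0 q_gt0 H_bounded tau_small).
- exact: resolvent_height.
- exact: weylE.
- move=> tau' z_tau'; rewrite -(weylE tau) // -weylE //.
  suff -> : normc tau' = normc tau by [].
  have M_gt0 : (0 < p + q)%N by rewrite addn_gt0 p_gt0.
  apply: (pexpIrn M_gt0); rewrite ?nnegrE ?normc_ge0 //.
  by rewrite -!normcX -z_tau -z_tau'.
Qed.
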